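(* Let $q$ be an odd prime power, $n=q^2+q+1$ and $k=\frac{q^2+q}{2}$ (so $n=2k+1$). Identify the point set of the projective plane $\mathbb{P}^2(\mathbb{F}_q)$ with $[n]$, so each line is a $(q+1)$-subset of $[n]$. For $q+1\le i\le k$ let $\mathcal{A}_i$ be the family of all $i$-element subsets of $[n]$ that contain (the point set of) some line of $\mathbb{P}^2(\mathbb{F}_q)$, and let $\mathcal{A}=\bigcup_{i=q+1}^{k}\mathcal{A}_i$. Let $\mathcal{Q}_k=\{A\subset[n]:|A|\geq k+1\}$, $\bar{\mathcal{A}}=\{[n]\setminus A: A\in\mathcal{A}\}$, and $$\mathcal{R}_k=\mathcal{A}\cup(\mathcal{Q}_k\setminus\bar{\mathcal{A}}).$$ Then $\mathcal{R}_k$ is a regular intersecting family, and $$\mathrm{div}(\mathcal{R}_k)-\mathrm{div}(\mathcal{Q}_k)>\sum_{i=q+1}^{k}\frac{n-2i}{2}\binom{n-q-1}{i-q-1}.$$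
   Context: $[n]=\{1,\ldots,n\}$ and $2^{[n]}$ is the family of all subsets of $[n]$. A family $\mathcal{F}\subset 2^{[n]}$ is intersecting if any two of its members have nonempty intersection. The degree of $x\in[n]$ in $\mathcal{F}$ is the number of members of $\mathcal{F}$ containing $x$; $\mathcal{F}$ is regular if all $x\in[n]$ have the same degree. For an intersecting family $\mathcal{F}$, its diversity is $\mathrm{div}(\mathcal{F})=|\mathcal{F}|-\max_{x\in[n]}|\mathcal{F}(x)|$, where $\mathcal{F}(x)=\{F\in\mathcal{F}: x\in F\}$. *)

(* Defs.v *)
From HB Require Import structures.
From mathcomp Require Export all_boot all_order all_algebra.

Set Implicit Arguments.
Unset Strict Implicit.
Unset Printing Implicit Defensive.

Section Families.

Variable T : finType.
Implicit Type F : {set {set T}}.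

Definition intersecting F : Prop :=
  forall A B, A \in F -> B \in F -> A :&: B != set0.

Definition degree F (x : T) : nat := #|[set A in F | x \in A]|.

Definition regular F : Prop := forall x y : T, degree F x = degree F y.

(* The truncated subtraction is exact, as every degree is at most #|F|. *)
Definition diversity F : nat := #|F| - \max_(x : T) degree F x.

Definition compl_family F : {set {set T}} := [set ~: A | A in F].

End Families.

(* Over a finite field, subspaces are encoded by canonical matrices, hence form
   a finite type. *)
Import VectorInternalTheory.

HB.instance Definition _ (K : finFieldType) (vT : vectType K) :=
  [Finite of {vspace vT} by <:].

Definition proj_point (K : finFieldType) : finType :=
  {U : {vspace 'rV[K]_3} | \dim U == 1}.

Section Construction.

Variables (K : finFieldType) (n : nat) (pt : 'I_n -> proj_point K).

(* [pt] labels the points of the projective plane by 'I_n; a projective line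
   is a plane W of K^3, viewed as the set of labels of the points it contains. *)
Definition line_set (W : {vspace 'rV[K]_3}) : {set 'I_n} :=
  [set x | (val (pt x) <= W)%VS].

Definition proj_lines : {set {set 'I_n}} :=
  [set line_set W | W : {vspace 'rV[K]_3} & \dim W == 2].

Definition family_Ai (i : nat) : {set {set 'I_n}} :=
  [set A : {set 'I_n} | (#|A| == i) && [exists L in proj_lines, L \subset A]].

Definition family_A (q k : nat) : {set {set 'I_n}} :=
  \bigcup_(q.+1 <= i < k.+1) family_Ai i.

Definition family_Q (k : nat) : {set {set 'I_n}} :=
  [set A : {set 'I_n} | k.+1 <= #|A|].

Definition family_R (q k : nat) : {set {set 'I_n}} :=
  family_A q k :|: (family_Q k :\: compl_family (family_A q k)).

End Construction.

Arguments family_Q n k : clear implicits.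

(* Main.v *)
Require Import Defs.
From mathcomp Require Import all_boot all_order all_algebra perm finfield zify.
Import Order.TTheory GRing.Theory Num.Theory.

(* Regularity comes from the transitivity of GL_3 on points, and the intersection
   property from the fact that two lines meet.  For a regular family F on n points,
   double counting gives n div(F) = sum over A in F of |~A|; passing from Q to R
   trades each ~A for A with A in the family of supersets of lines, so that
   n (div R - div Q) = sum_i (n - 2i) |A_i|.  By Bonferroni,
   2 |A_i| >= 2 n C1 - n (n - 1) C2, where C1 and C2 count the i-sets containing
   one given line and two given lines, respectively; as (n - 1) C2 < C1, this
   yields 2 |A_i| > n C1. *)

(** * Lines and planes through the origin in a vector space *)

Lemma vline_dim1 {F : fieldType} {vT : vectType F} (U : {vspace vT}) :
  \dim U = 1 -> exists2 u : vT, u != 0%R & U = <[u]>%VS.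
Proof.
move=> dimU; have U0: vpick U != 0%R by rewrite vpick0 -dimv_eq0 dimU.
exists (vpick U) => //; apply/eqP; rewrite eq_sym eqEdim -memvE memv_pick.
by rewrite dimU dim_vline U0.
Qed.

Lemma subv_vline_eq {F : fieldType} {vT : vectType F} (U : {vspace vT}) (v : vT) :
  \dim U = 1 -> v != 0%R -> (v \in U) = (U == <[v]>%VS).
Proof.
move=> dimU v0; apply/idP/eqP => [vU|->]; last exact: memv_line.
by apply/esym/eqP; rewrite eqEdim -memvE vU dimU dim_vline v0.
Qed.

Lemma ltn_dim_cap {F : fieldType} {vT : vectType F} (U V : {vspace vT}) :
  \dim U = \dim V -> U != V -> \dim (U :&: V) < \dim U.
Proof.
move=> dimUV UV; rewrite (ltn_leqif (dimv_leqif_sup (capvSl U V))) subv_cap subvv andTb.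
by apply: contra UV => sUV; rewrite eqEdim sUV dimUV leqnn.
Qed.

Lemma dim_add_distinct {F : fieldType} {vT : vectType F} (U V : {vspace vT}) :
  \dim U = 1 -> \dim V = 1 -> U != V -> \dim (U + V) = 2.
Proof.
move=> dimU dimV UV; have := dimv_sum_cap U V; have := ltn_dim_cap U V.
rewrite dimU dimV ltnS leqn0 => /(_ erefl UV)/eqP->.
by rewrite addn0.
Qed.

(** The sum has dimension at most 3, so the dimension formula leaves at least 1 for the
    intersection; distinctness keeps it below 2. *)
Lemma dim_cap_planes {F : fieldType} (U V : {vspace 'rV[F]_3}) :
  \dim U = 2 -> \dim V = 2 -> U != V -> \dim (U :&: V) = 1.
Proof.
move=> dimU dimV UV; have := dimv_sum_cap U V; have := ltn_dim_cap U V.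
rewrite dimU dimV ltnS => /(_ erefl UV) le1 e.
apply/eqP; rewrite eqn_leq le1 -(leq_add2l (\dim (U + V))) e addn1.
by apply: leq_trans (dimvS (subvf _)) _; rewrite dimvf dim_matrix mul1r.
Qed.

(** * Incidence in the projective plane *)

Lemma proj_point_dim {K : finFieldType} (p : proj_point K) : \dim (val p) = 1.
Proof. by apply/eqP; case: p. Qed.

Lemma pt_surj {K : finFieldType} {n : nat} {pt : 'I_n -> proj_point K}
    (U : {vspace 'rV[K]_3}) :
  bijective pt -> \dim U = 1 -> exists x, val (pt x) = U.
Proof.
case=> g _ ptK /eqP dimU; exists (g (Sub U dimU)).
by rewrite ptK SubK.
Qed.

Lemma val_pt_inj {K : finFieldType} {n : nat} {pt : 'I_n -> proj_point K} :
  bijective pt -> injective (fun x => val (pt x)).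
Proof. by move=> /bij_inj ptI x y /val_inj /ptI. Qed.

(** The nonzero vectors of [W] are counted twice: there are [#|K| ^ 2 - 1] of them, each spans
    exactly one point of the line, and each point holds [#|K| - 1] of them. *)
Lemma card_line_set {K : finFieldType} {n : nat} {pt : 'I_n -> proj_point K}
    (W : {vspace 'rV[K]_3}) :
  bijective pt -> \dim W = 2 -> #|line_set pt W| = #|K|.+1.
Proof.
move=> ptB dimW; have K1 := finNzRing_gt1 K.
have cnt (U : {vspace 'rV[K]_3}) : \sum_(v | (v != 0%R) && (v \in U)) 1 = #|K| ^ \dim U - 1.
  rewrite sum1_card -(card_vspace U) (cardD1 0%R U) mem0v addKn.
  by apply: eq_card => v; rewrite !inE.
have : \sum_(v | (v != 0%R) && (v \in W)) 1
     = \sum_(v | (v != 0%R) && (v \in W)) \sum_(x in line_set pt W | v \in val (pt x)) 1.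
  apply: eq_bigr => v /andP[v0 vW].
  have [|x xv] := @pt_surj _ _ _ <[v]>%VS ptB; first by rewrite dim_vline v0.
  rewrite (big_pred1 x) // => y; rewrite inE subv_vline_eq ?proj_point_dim //.
  rewrite -xv; apply/andP/eqP => [[_ /eqP /(val_pt_inj ptB)] //| ->].
  by rewrite eqxx xv -memvE.
rewrite cnt dimW.
rewrite (exchange_big_dep (fun x => x \in line_set pt W)) /=; last by move=> v x _ /andP[].
have eS x : x \in line_set pt W ->
    \sum_(v | [&& v != 0%R, v \in W & (x \in line_set pt W) && (v \in val (pt x))]) 1
      = #|K| - 1.
  move=> xL; have := cnt (val (pt x)); rewrite proj_point_dim expn1 => <-.
  apply: eq_bigl => v; rewrite xL /=; case: (v != 0%R) => //=.
  apply/andP/idP => [[]//|vx]; split=> //.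
  by move: xL; rewrite inE => /subvP; apply.
under eq_bigr => x xL.
  under eq_bigl => v do rewrite -andbA.
  rewrite eS //; over.
rewrite sum_nat_const (subn_sqr _ 1) addn1 mulnC => /eqP.
by rewrite eqn_pmul2r ?subn_gt0 // => /eqP.
Qed.

Lemma card_line_setI {K : finFieldType} {n : nat} {pt : 'I_n -> proj_point K}
    (W W' : {vspace 'rV[K]_3}) :
  bijective pt -> \dim W = 2 -> \dim W' = 2 -> W != W' ->
  #|line_set pt W :&: line_set pt W'| = 1.
Proof.
move=> ptB dimW dimW' WW'; have dimI := dim_cap_planes _ _ dimW dimW' WW'.
have [x xI] := pt_surj _ ptB dimI; apply/eqP/cards1P; exists x.
apply/setP => y; rewrite !inE -subv_cap -xI; apply/idP/eqP => [yx|->//].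
by apply: (val_pt_inj ptB); apply/eqP; rewrite eqEdim yx !proj_point_dim.
Qed.

Lemma proj_linesP {K : finFieldType} {n : nat} {pt : 'I_n -> proj_point K}
    (L : {set 'I_n}) :
  reflect (exists2 W : {vspace 'rV[K]_3}, \dim W = 2 & L = line_set pt W)
          (L \in proj_lines pt).
Proof.
apply: (iffP imsetP) => -[W dimW ->]; exists W => //.
  by move: dimW; rewrite inE => /eqP.
by rewrite inE dimW.
Qed.

Lemma card_proj_line {K : finFieldType} {n : nat} {pt : 'I_n -> proj_point K}
    (L : {set 'I_n}) :
  bijective pt -> L \in proj_lines pt -> #|L| = #|K|.+1.
Proof. by move=> ptB /proj_linesP[W dimW ->]; apply: card_line_set. Qed.

Lemma card_proj_lineI {K : finFieldType} {n : nat} {pt : 'I_n -> proj_point K}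
    (L L' : {set 'I_n}) :
  bijective pt -> L \in proj_lines pt -> L' \in proj_lines pt -> L != L' ->
  #|L :&: L'| = 1.
Proof.
move=> ptB /proj_linesP[W dimW ->] /proj_linesP[W' dimW' ->] neq.
by apply: card_line_setI => //; apply: contra neq => /eqP->.
Qed.

Lemma proj_line_through {K : finFieldType} {n : nat} {pt : 'I_n -> proj_point K}
    (x y : 'I_n) :
  bijective pt -> x != y -> exists2 L, L \in proj_lines pt & (x \in L) && (y \in L).
Proof.
move=> ptB xy; exists (line_set pt (val (pt x) + val (pt y))).
  apply/proj_linesP; exists (val (pt x) + val (pt y))%VS => //.
  by apply: dim_add_distinct; rewrite ?proj_point_dim ?(inj_eq (val_pt_inj ptB)).
by rewrite !inE addvSl addvSr.
Qed.

(** * Transitivity of the linear group on points *)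

Lemma linear_transitive {F : fieldType} {n : nat} (u v : 'rV[F]_n) :
  u != 0%R -> v != 0%R -> exists2 g : 'End('rV[F]_n), lker g == 0%VS & g u = v.
Proof.
move=> u0 v0; have uF : row_free u by rewrite /row_free rank_rV u0.
(* The matrix [pinvmx u *m v] already sends [u] to [v]. It keeps the rank of [u], so an invertible
   [M] with the same value at [u] exists. *)
have [|M Mu uM] := @complete_unitmx _ _ _ u (pinvmx u *m v)%R.
  by rewrite mulmxA mulmxVp // mul1mx !rank_rV u0 v0.
exists (linfun (mulmxr M)); last by rewrite lfunE /= -uM mulmxA mulmxVp // mul1mx.
apply/lker0P => a b; rewrite !lfunE /= => /(congr1 (mulmxr (invmx M))) /=.
by rewrite !mulmxK.
Qed.

(** The map [s] is the collineation induced by an invertible linear map taking a spanning vector of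
    the point [x] to one of the point [y]. *)
Lemma proj_lines_transitive {K : finFieldType} {n : nat} {pt : 'I_n -> proj_point K}
    (x y : 'I_n) :
  bijective pt ->
  exists s : 'I_n -> 'I_n, [/\ injective s, s x = y
    & forall L, L \in proj_lines pt -> s @: L \in proj_lines pt].
Proof.
move=> ptB.
have [u u0 xu] := vline_dim1 _ (proj_point_dim (pt x)).
have [v v0 yv] := vline_dim1 _ (proj_point_dim (pt y)).
have [g g0 guv] := linear_transitive _ _ u0 v0.
have dimg (U : {vspace 'rV[K]_3}) : \dim (g @: U) = \dim U.
  by apply: limg_dim_eq; rewrite (eqP g0) capv0.
have ex z : exists t, val (pt t) == (g @: val (pt z))%VS.
  have [|t tz] := @pt_surj _ _ _ (g @: val (pt z))%VS ptB.
    by rewrite dimg proj_point_dim.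
  by exists t; apply/eqP.
pose s z := xchoose (ex z); have sE z : val (pt (s z)) = (g @: val (pt z))%VS.
  exact/eqP/(xchooseP (ex z)).
have sI : injective s.
  move=> a b /(congr1 (fun z => val (pt z))); rewrite !sE => e.
  apply: (val_pt_inj ptB); apply/eqP.
  by rewrite eqEdim -(limg_ker0 _ _ g0) e subvv !proj_point_dim.
exists s; split=> //.
  by apply: (val_pt_inj ptB); rewrite sE xu yv limg_line guv.
move=> L /proj_linesP[W dimW ->]; apply/proj_linesP; exists (g @: W)%VS.
  by rewrite dimg.
(* Inclusion suffices: [s] is injective, so both sides have [#|K| + 1] elements. *)
apply/eqP; rewrite eqEcard; apply/andP; split.
  apply/subsetP => _ /imsetP[a + ->]; rewrite !inE sE => aW.
  by rewrite limg_ker0.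
by rewrite card_imset // !card_line_set // dimg.
Qed.

(** * Double counting: lines, supersets and pairs of lines *)

Definition distinct_pairs {T : finType} (A : {set T}) : {set T * T} :=
  [set p | [&& p.1 \in A, p.2 \in A & p.1 != p.2]].

Lemma card_distinct_pairs {T : finType} (A : {set T}) :
  #|distinct_pairs A| = #|A| * #|A|.-1.
Proof.
transitivity (\sum_(x in A) \sum_(y in A :\ x) 1).
  rewrite pair_big_dep /= sum1_card; apply: eq_card => p.
  by rewrite inE [RHS]unfold_in /= !inE [p.2 == _]eq_sym [(p.2 \in A) && _]andbC.
rewrite (eq_bigr (fun _ => #|A|.-1)) ?sum_nat_const // => x xA.
by rewrite sum1_card (cardsD1 x A) xA.
Qed.

(** Each ordered pair of distinct points lies on exactly one line, and each line carries [q.+1 * q]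
    such pairs. There are [#|T| * (q ^ 2 + q)] pairs in all, and [q ^ 2 + q = q.+1 * q]. *)
Lemma card_projective_lines {T : finType} {Ls : {set {set T}}} {q : nat} :
  0 < q -> #|T| = q ^ 2 + q + 1 ->
  (forall L, L \in Ls -> #|L| = q.+1) ->
  (forall L L', L \in Ls -> L' \in Ls -> L != L' -> #|L :&: L'| = 1) ->
  (forall x y, x != y -> exists2 L, L \in Ls & (x \in L) && (y \in L)) ->
  #|Ls| = #|T|.
Proof.
move=> q0 cT cL cI thr.
have : #|distinct_pairs [set: T]|
     = \sum_(p in distinct_pairs [set: T]) \sum_(L in Ls | p \in distinct_pairs L) 1.
  rewrite -sum1_card; apply: eq_bigr => p; rewrite !inE /= => np.
  have [L LLs /andP[p1 p2]] := thr _ _ np.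
  rewrite (big_pred1 L) // => L'; rewrite !inE np andbT.
  apply/idP/eqP => [/and3P[L'Ls q1 q2]|->]; last by rewrite LLs p1 p2.
  apply/eqP/negPn/negP => neq; have := cI _ _ L'Ls LLs neq.
  move/eqP/cards1P => [z zE]; case/eqP: np.
  have : p.1 \in L' :&: L by rewrite inE q1.
  have : p.2 \in L' :&: L by rewrite inE q2.
  by rewrite zE !inE => /eqP-> /eqP->.
rewrite (exchange_big_dep (fun L => L \in Ls)) /=; last by move=> p L _ /andP[].
rewrite (eq_bigr (fun _ => q.+1 * q)) => [|L LLs]; last first.
  rewrite -[q in RHS]/(q.+1.-1) -(cL _ LLs) -card_distinct_pairs -sum1_card.
  apply: eq_bigl => p; rewrite LLs /= !inE.
  by case: (p.1 \in L) (p.2 \in L) => [] [] //=; rewrite ?andbT ?andbF ?andbb.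
rewrite sum_nat_const card_distinct_pairs cardsT cT addn1 /= => e.
have : (q ^ 2 + q).+1 * (q.+1 * q) = #|Ls| * (q.+1 * q) by rewrite -e; lia.
by move/eqP; rewrite eqn_pmul2r ?muln_gt0 // => /eqP.
Qed.

(* Writing 'C(_, #|T| - i) rather than 'C(_, i - #|B|) keeps the formula valid
   when i < #|B|, where truncated subtraction would give 1. *)
Lemma card_supersets {T : finType} (B : {set T}) (i : nat) :
  i <= #|T| ->
  #|[set A : {set T} | (#|A| == i) && (B \subset A)]| = 'C(#|T| - #|B|, #|T| - i).
Proof.
move=> iT; rewrite -(card_imset _ (@setC_inj T)) -[in #|B|](setCK B) -cardsCs -cards_draws.
apply: eq_card => A; rewrite !inE; apply/imsetP/andP => [[A' + ->]|[sA /eqP cA]].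
  by rewrite inE setCS => /andP[/eqP<- ->]; rewrite cardsCs setCK.
exists (~: A); rewrite ?setCK // inE -setCS setCK sA andbT.
by rewrite cardsCs setCK cA subKn.
Qed.

(* With m the number of lines inside A, Bonferroni reads 2 [m > 0] >= 2m - m(m-1). *)
Lemma bonferroni_supersets {T : finType} (Ls : {set {set T}}) (S : {set {set T}}) :
  2 * (\sum_(L in Ls) #|[set A in S | L \subset A]|)
  <= 2 * #|[set A in S | [exists L in Ls, L \subset A]]|
     + \sum_(p in distinct_pairs Ls) #|[set A in S | p.1 :|: p.2 \subset A]|.
Proof.
pose m (A : {set T}) := [set L in Ls | L \subset A].
have -> : \sum_(L in Ls) #|[set A in S | L \subset A]| = \sum_(A in S) #|m A|.
  under eq_bigr do rewrite -sum1dep_card; under [RHS]eq_bigr do rewrite -sum1dep_card.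
  rewrite (exchange_big_dep (fun A => A \in S)) /=; last by move=> ? ? _ /andP[].
  by apply: eq_bigr => A AS; apply: eq_bigl => L; rewrite AS.
have -> : \sum_(p in distinct_pairs Ls) #|[set A in S | p.1 :|: p.2 \subset A]|
        = \sum_(A in S) #|distinct_pairs (m A)|.
  under eq_bigr do rewrite -sum1dep_card.
  rewrite (exchange_big_dep (fun A => A \in S)) /=; last by move=> ? ? _ /andP[].
  apply: eq_bigr => A AS; rewrite sum1_card; apply: eq_card => p.
  rewrite [LHS]unfold_in /= !inE subUset AS /=.
  by case: (p.1 \in Ls) (p.2 \in Ls) (p.1 \subset A) => [] [] [] /=; rewrite ?andbF // andbC.
have -> : #|[set A in S | [exists L in Ls, L \subset A]]| = \sum_(A in S) (0 < #|m A|).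
  rewrite -sum1dep_card big_mkcondr; apply: eq_bigr => A _.
  have -> : [exists L in Ls, L \subset A] = (0 < #|m A|).
    by apply/existsP/card_gt0P => -[L LA]; exists L; rewrite inE in LA *.
  by case: (0 < _).
rewrite !big_distrr -big_split /=; apply: leq_sum => A _.
by rewrite card_distinct_pairs; case: #|m A| => [|[|[|j]]] //=; nia.
Qed.

(** * Binomial estimates for the overlap of two lines *)

Lemma leq_pow2_bin (r N D : nat) : N + r <= D.*2 -> 2 ^ r * 'C(N, D) <= 'C(N + r, D).
Proof.
elim: r => [|r IH] h; first by rewrite expn0 mul1n addn0.
have {}IH : 2 ^ r * 'C(N, D) <= 'C(N + r, D) by apply: IH; lia.
have [le|gt] := leqP D (N + r); last by rewrite bin_small ?muln0 //; lia.
have e := mul_bin_down (N + r).+1 D; rewrite /= in e.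
(* With M = N + r, the identity [e] gives the ratio (M + 1) / (M + 1 - D) for consecutive binomials;
   it is at least 2 because M + 1 <= 2 D. *)
have : 2 * 'C(N + r, D) <= 'C((N + r).+1, D).
  rewrite -(leq_pmul2l (_ : 0 < (N + r).+1 - D)); last by lia.
  rewrite -e mulnA leq_mul2r; apply/orP; right; lia.
rewrite expnS -mulnA addnS; apply: leq_trans; exact: leq_mul.
Qed.

Lemma ltn_sqr_add_pow2 (q : nat) : 5 <= q -> q ^ 2 + q < 2 ^ q.
Proof.
elim: q => // q IH; rewrite leq_eqVlt => /orP[/eqP<- //|]; rewrite ltnS => q5.
by have := IH q5; rewrite [2 ^ q.+1]expnS -!mulnn; nia.
Qed.

(* The ratio of the two binomials is at most 2^-q, which suffices for q >= 5;
   for q = 3 (and whenever i <= 2q) the left-hand binomial vanishes. *)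
Lemma ltn_overlap_bin (q i : nat) :
  odd q -> 1 < q -> q.+1 <= i -> 2 * i <= q ^ 2 + q ->
  (q ^ 2 + q) * 'C(q ^ 2 + q + 1 - q.*2.+1, q ^ 2 + q + 1 - i)
    < 'C(q ^ 2 + q + 1 - q.+1, q ^ 2 + q + 1 - i).
Proof.
move=> oq q1 qi ik; have C1 : 0 < 'C(q ^ 2 + q + 1 - q.+1, q ^ 2 + q + 1 - i).
  by rewrite bin_gt0; lia.
have [|lt] := leqP i q.*2; first by move=> iq; rewrite bin_small ?muln0 //; lia.
have q5 : 5 <= q.
  by case: q oq q1 ik lt {qi C1} => [|[|[|[|[|q]]]]] //= _ _; rewrite -mulnn; lia.
have [->|C2] := posnP 'C(q ^ 2 + q + 1 - q.*2.+1, q ^ 2 + q + 1 - i); first by rewrite muln0.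
have -> : q ^ 2 + q + 1 - q.+1 = q ^ 2 + q + 1 - q.*2.+1 + q by rewrite -mulnn; nia.
apply: (@leq_trans (2 ^ q * 'C(q ^ 2 + q + 1 - q.*2.+1, q ^ 2 + q + 1 - i))).
  by rewrite ltn_pmul2r // ltn_sqr_add_pow2.
(* The condition to check is [q ^ 2 <= 2 * (q ^ 2 + q + 1 - i)], which follows from
   [2 * i <= q ^ 2 + q]. *)
by apply: leq_pow2_bin; rewrite -mulnn in ik *; nia.
Qed.

(** * Sums over the supersets of lines; degrees and diversity *)

Lemma in_family_A {K : finFieldType} {n : nat} (pt : 'I_n -> proj_point K)
    (q k : nat) (A : {set 'I_n}) :
  (A \in family_A pt q k)
  = (q < #|A| <= k) && [exists L in proj_lines pt, L \subset A].
Proof.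
rewrite /family_A (big_nat_widenl _ 0) // big_mkord.
apply/bigcupP/andP => [[i qi]|[/andP[qA Ak] ex]].
  rewrite inE => /andP[/eqP-> ex]; split=> //; rewrite -[_ <= k]ltnS ltn_ord andbT; exact: qi.
by exists (Ordinal (Ak : #|A| < k.+1)) => //; rewrite inE eqxx.
Qed.

Lemma sum_family_A {K : finFieldType} {n : nat} (pt : 'I_n -> proj_point K)
    (q k : nat) (w : nat -> nat) :
  \sum_(A in family_A pt q k) w #|A|
  = \sum_(q.+1 <= i < k.+1) #|family_Ai pt i| * w i.
Proof.
rewrite (eq_bigr (fun A : {set 'I_n} => \sum_(q.+1 <= i < k.+1 | i == #|A|) w i)); last first.
  by move=> A; rewrite in_family_A big_nat1_eq => /andP[-> _].
rewrite (exchange_big_dep xpredT) //=; apply: eq_big_nat => i qik.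
rewrite -sum_nat_const; apply: eq_bigl => A; rewrite in_family_A inE.
by have [<-|] := eqVneq i #|A|; rewrite ?andbF // qik andbT.
Qed.

Lemma degree_sum {T : finType} (F : {set {set T}}) (x : T) :
  degree F x = \sum_(A in F) (x \in A).
Proof. by rewrite /degree -sum1dep_card big_mkcondr; apply: eq_bigr => A _; case: ifP. Qed.

(** Such an [s] carries the members through [x] injectively to members through [y], so degrees do
    not decrease from [x] to [y]; exchanging the points gives equality. *)
Lemma transitive_regular {T : finType} (F : {set {set T}}) :
  (forall x y, exists s : T -> T, [/\ injective s, s x = y
     & forall A, A \in F -> s @: A \in F]) ->
  regular F.
Proof.
move=> tr x y; have le a b : degree F a <= degree F b.
  have [s [sI <- sF]] := tr a b.
  rewrite /degree -(card_imset _ (imset_inj sI)); apply: subset_leq_card.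
  apply/subsetP => _ /imsetP[A + ->]; rewrite !inE => /andP[AF aA].
  by rewrite sF //= imset_f.
by apply/eqP; rewrite eqn_leq !le.
Qed.

Lemma regular_diversity {T : finType} (F : {set {set T}}) :
  regular F -> #|T| * diversity F = \sum_(A in F) #|~: A|.
Proof.
move=> regF; rewrite -sum_nat_const.
rewrite (eq_bigr (fun x => \sum_(A in F | x \notin A) 1)) => [|x _]; last first.
  (* By regularity every point attains the maximum degree, so the diversity counts the members
     avoiding [x], whichever [x] is. *)
  have -> : diversity F = #|F| - degree F x.
    congr (_ - _); apply/eqP; rewrite eqn_leq leq_bigmax andbT.
    by apply/bigmax_leqP => y _; rewrite (regF y x).
  apply/eqP; rewrite -(eqn_add2l (degree F x)) subnKC; last first.
    by apply/subset_leq_card/subsetP => A; rewrite inE => /andP[].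
  by rewrite -[#|F|]sum1_card (bigID (fun A : {set T} => x \in A)) /= sum1dep_card.
rewrite (exchange_big_dep (fun A => A \in F)) /=; last by move=> ? ? _ /andP[].
apply: eq_bigr => A AF; rewrite sum1_card; apply: eq_card => x.
by rewrite !inE unfold_in AF.
Qed.

(** * Exchange identity, regularity and intersection for the family R *)

Lemma card_family_A_le {K : finFieldType} {n : nat} (pt : 'I_n -> proj_point K)
    (q k : nat) (A : {set 'I_n}) : A \in family_A pt q k -> #|A| <= k.
Proof. by rewrite in_family_A => /andP[/andP[]]. Qed.

(** The exchange of each [~: A] for [A], with the removed terms moved to the left so that no
    subtraction occurs. The weight is arbitrary because the identity serves both degrees ([w] an
    indicator) and diversity ([w] the size of the complement). *)
Lemma sum_family_R {K : finFieldType} {n : nat} (pt : 'I_n -> proj_point K)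
    (q k : nat) (w : {set 'I_n} -> nat) :
  n = k.*2.+1 ->
  \sum_(A in family_R pt q k) w A + \sum_(A in family_A pt q k) w (~: A)
  = \sum_(A in family_A pt q k) w A + \sum_(A in family_Q n k) w A.
Proof.
(* Since [n] is [2k + 1], complements of sets of size at most [k] have size at least [k + 1]. *)
move=> nk; have sub : compl_family (family_A pt q k) \subset family_Q n k.
  apply/subsetP => _ /imsetP[A /card_family_A_le AF ->].
  by rewrite inE cardsCs setCK card_ord; lia.
have disj : family_A pt q k :&: (family_Q n k :\: compl_family (family_A pt q k)) = set0.
  apply/setP => A; rewrite !inE; apply/negP.
  by case/and3P => /card_family_A_le AF _; rewrite ltnNge AF.
rewrite /family_R (big_setID (family_A pt q k)) /= setUK setDUl setDv set0U.
rewrite (setDidPl _) -?setI_eq0 1?setIC ?disj //.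
rewrite -addnA; congr (_ + _).
rewrite [RHS](big_setID (compl_family (family_A pt q k))) /= addnC; congr (_ + _).
rewrite (setIidPr sub) /compl_family big_imset //.
by move=> A B _ _; apply: setC_inj.
Qed.

Lemma regular_family_Q (n k : nat) : regular (family_Q n k).
Proof.
apply: transitive_regular => x y; exists (tperm x y).
by split=> [||A]; [exact: perm_inj | exact: tpermL | rewrite !inE card_imset //; exact: perm_inj].
Qed.

(* The degree of x in R is deg_A(x) + deg_Q(x) - (|A| - deg_A(x)). *)
Lemma regular_family_R {K : finFieldType} {n : nat} (pt : 'I_n -> proj_point K)
    (q k : nat) :
  n = k.*2.+1 -> bijective pt -> regular (family_R pt q k).
Proof.
move=> nk ptB.
have regA : regular (family_A pt q k).
  apply: transitive_regular => x y; have [s [sI sx sL]] := proj_lines_transitive x y ptB.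
  exists s; split=> // A; rewrite !in_family_A card_imset // => /andP[->] /=.
  case/existsP => L /andP[LL LA]; apply/existsP; exists (s @: L).
  by rewrite sL // imsetS.
have regQ := regular_family_Q n k.
move=> x y; have ex z := sum_family_R pt q k (fun A => z \in A) nk.
have := ex y; have := ex x; rewrite -!degree_sum (regA x y) (regQ x y) => <-.
suff -> : \sum_(A in family_A pt q k) (x \in ~: A)
        = \sum_(A in family_A pt q k) (y \in ~: A) by move=> /addIn.
apply: (@addnI (degree (family_A pt q k) x)); rewrite [in RHS](regA x y) !degree_sum -!big_split /=.
by apply: eq_bigr => A _; rewrite !inE; case: (x \in A) (y \in A) => [] [].
Qed.

Lemma intersecting_family_R {K : finFieldType} {n : nat} (pt : 'I_n -> proj_point K)
    (q k : nat) :
  n = k.*2.+1 -> 0 < #|K| -> bijective pt -> intersecting (family_R pt q k).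
Proof.
move=> nk K0 ptB.
(* If [A] and [B] were disjoint, [~: B] would contain the line inside [A] and have at most [k]
   elements, so [B] would be one of the removed complements. *)
have mixed A B : A \in family_A pt q k -> B \in family_Q n k ->
    B \notin compl_family (family_A pt q k) -> A :&: B != set0.
  move=> AA BQ; apply: contra; rewrite setI_eq0 disjoints_subset => AB.
  apply/imsetP; exists (~: B); rewrite ?setCK //; move: AA BQ.
  rewrite !in_family_A inE; have cB : #|~: B| = n - #|B| by rewrite cardsCs setCK card_ord.
  move=> /andP[/andP[qA Ak] /existsP[L /andP[LL LA]]] kB.
  have cAB := subset_leq_card AB; rewrite cB in cAB *.
  apply/andP; split; first by lia.
  by apply/existsP; exists L; rewrite LL (subset_trans LA AB).
move=> A B; rewrite !inE => /orP[AA|/andP[nA AQ]] /orP[BA|/andP[nB BQ]].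
- move: AA BA; rewrite !in_family_A => /andP[_ /existsP[L /andP[LL LA]]].
  case/andP=> _ /existsP[L' /andP[LL' LB]].
  suff : L :&: L' != set0.
    by rewrite -!card_gt0 => /leq_trans; apply; apply/subset_leq_card/setISS.
  have [<-|neq] := eqVneq L L'; first by rewrite setIid -card_gt0 (card_proj_line _ ptB LL).
  by rewrite -card_gt0 (card_proj_lineI _ _ ptB LL LL').
- by apply: mixed; rewrite // inE.
- by rewrite setIC; apply: mixed; rewrite // inE.
(* Two sets of size at least [k + 1] cannot be disjoint among [2k + 1] points. *)
- rewrite -card_gt0; have := cardsUI A B; have := subset_leq_card (subsetT (A :|: B)).
  by rewrite cardsT card_ord; lia.
Qed.

(** * Lower bound on the families A_i and comparison of diversities *)

Lemma ltn_card_family_Ai {K : finFieldType} {n : nat} (pt : 'I_n -> proj_point K)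
    (q i : nat) :
  #|K| = q -> odd q -> n = q ^ 2 + q + 1 -> bijective pt ->
  q.+1 <= i -> 2 * i <= q ^ 2 + q ->
  n * 'C(n - q - 1, i - q - 1) < 2 * #|family_Ai pt i|.
Proof.
move=> hK oq hn ptB qi ik; have q1 : 1 < q by rewrite -hK finNzRing_gt1.
have cL L : L \in proj_lines pt -> #|L| = q.+1 by rewrite -hK; apply: card_proj_line.
have cI L L' : L \in proj_lines pt -> L' \in proj_lines pt -> L != L' -> #|L :&: L'| = 1.
  exact: card_proj_lineI.
have cLs : #|proj_lines pt| = n.
  rewrite -[RHS]card_ord; apply: (card_projective_lines (ltnW q1)) => //.
    by rewrite card_ord.
  by move=> x y; apply: proj_line_through.
have iT : i <= #|'I_n| by rewrite card_ord hn; lia.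
have sup (B : {set 'I_n}) :
    #|[set A in [set A : {set 'I_n} | #|A| == i] | B \subset A]| = 'C(n - #|B|, n - i).
  have := card_supersets B i iT; rewrite card_ord => <-.
  by apply: eq_card => A; rewrite !inE.
have := bonferroni_supersets (proj_lines pt) [set A : {set 'I_n} | #|A| == i].
rewrite (eq_bigr (fun _ => 'C(n - q.+1, n - i))) => [|L LL]; last by rewrite sup cL.
(* Two distinct lines share one point, so their union has [2q + 1] points. *)
rewrite [in X in _ <= X](eq_bigr (fun _ => 'C(n - q.*2.+1, n - i))) => [|[L L']]; last first.
  rewrite inE /= => /and3P[LL LL' neq]; rewrite sup /=.
  congr ('C(n - _, _)); have := cardsUI L L'; rewrite cI // (cL L) // (cL L') // addn1 addSn => -[->]; lia.
rewrite !sum_nat_const card_distinct_pairs cLs.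
have -> : #|[set A in [set A : {set 'I_n} | #|A| == i] | [exists L in proj_lines pt, L \subset A]]|
        = #|family_Ai pt i|.
  by apply: eq_card => A; rewrite !inE.
have := ltn_overlap_bin q i oq q1 qi ik; rewrite -hn.
have -> : 'C(n - q - 1, i - q - 1) = 'C(n - q.+1, n - i).
  by rewrite -bin_sub; [congr 'C(_, _); lia | lia].
have -> : q ^ 2 + q = n.-1 by rewrite hn addn1.
move: 'C(_, _) 'C(_, _) #|_| => C1 C2 a lt12 le.
have n0 : 0 < n by rewrite hn addn1.
have : n * (n.-1 * C2) < n * C1 by rewrite ltn_pmul2l.
by move: le; rewrite -mulnA; lia.
Qed.

Lemma diversity_family_R {K : finFieldType} {n : nat} (pt : 'I_n -> proj_point K)
    (q k : nat) :
  n = k.*2.+1 -> bijective pt ->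
  n * diversity (family_R pt q k)
  = n * diversity (family_Q n k) + \sum_(q.+1 <= i < k.+1) #|family_Ai pt i| * (n - 2 * i).
Proof.
move=> nk ptB.
have cC (A : {set 'I_n}) : #|~: A| = n - #|A| by rewrite cardsCs setCK card_ord.
have := regular_diversity _ (regular_family_R pt q k nk ptB).
have := regular_diversity _ (regular_family_Q n k).
have := sum_family_R pt q k (fun A => #|~: A|) nk; rewrite card_ord.
(* Trading [~: A] for [A] changes the complement size from [#|A|] to [n - #|A|]. The gain
   [n - 2 * #|A|] is not truncated, as [#|A| <= k]. *)
have -> : \sum_(A in family_A pt q k) #|~: A|
        = \sum_(A in family_A pt q k) #|~: ~: A|
          + \sum_(q.+1 <= i < k.+1) #|family_Ai pt i| * (n - 2 * i).
  rewrite -(sum_family_A pt q k (fun i => n - 2 * i)) -big_split /=.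
  have nE a : a <= k -> n - a = a + (n - 2 * a) by lia.
  by apply: eq_bigr => A /card_family_A_le Ak; rewrite setCK cC; apply: nE.
by move=> + -> ->; rewrite -addnA addnC => /addnI ->; rewrite addnC.
Qed.

Theorem theorem2p2 (q n k : nat) (K : finFieldType) (pt : 'I_n -> proj_point K)
    (hK : #|K| = q) (hq : odd q)
    (hn : n = q ^ 2 + q + 1) (hk : k = (q ^ 2 + q) %/ 2)
    (hpt : bijective pt) :
  regular (family_R pt q k) /\
  intersecting (family_R pt q k) /\
  ((diversity (family_R pt q k))%:R - (diversity (family_Q n k))%:R
     > \sum_(q.+1 <= i < k.+1)
         (n%:R - 2%:R * i%:R) / 2%:R * ('C(n - q - 1, i - q - 1))%:R :> rat)%R.
Proof.
have q1 : 1 < q by rewrite -hK finNzRing_gt1.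
have e2 : q ^ 2 + q = k.*2.
  have : ~~ odd (q ^ 2 + q) by rewrite oddD oddX hq.
  by rewrite hk; lia.
have nk : n = k.*2.+1 by rewrite hn e2 addn1.
(* The range of summation is nonempty, which the strictness of the final inequality requires. *)
have qk : q < k.
  have q3 : 2 < q by case: q hq q1 {hK hn hk e2} => [|[|[|q]]].
  by rewrite -ltn_double -e2 -mulnn; nia.
split; first exact: regular_family_R.
split; first by apply: intersecting_family_R => //; rewrite hK ltnW.
have n0 : 0 < n by rewrite nk.
have := diversity_family_R pt q k nk hpt.
set dR := diversity _; set dQ := diversity _ => eqd.
have lt i : q.+1 <= i < k.+1 ->
    n * ((n - 2 * i) * 'C(n - q - 1, i - q - 1))
      < 2 * (#|family_Ai pt i| * (n - 2 * i)).
  case/andP=> qi ik; rewrite mulnCA mulnC mulnA ltn_pmul2r; last by lia.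
  by apply: ltn_card_family_Ai => //; rewrite e2; lia.
(* The claim is doubled to stay in the natural numbers, then multiplied by [n] to use [eqd]. The
   first summand is compared strictly, the others weakly. *)
have : 2 * dQ + \sum_(q.+1 <= i < k.+1) (n - 2 * i) * 'C(n - q - 1, i - q - 1) < 2 * dR.
  rewrite -(ltn_pmul2l n0) mulnDr [n * (2 * dR)]mulnCA eqd mulnDr mulnCA ltn_add2l.
  have qk' : q.+1 < k.+1 by [].
  rewrite !big_distrr /= (big_ltn qk') (big_ltn qk') -addSn leq_add ?lt ?leqnn //.
  rewrite !big_seq; apply: leq_sum => i; rewrite mem_index_iota => /andP[qi ik].
  by apply/ltnW/lt; rewrite ik (ltnW qi).
rewrite -(ltr_nat rat) natrD !natrM natr_sum => lt2.
(* As [2 * i <= n] on this range, the natural subtraction agrees with the rational one. *)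
rewrite (eq_big_nat _ _ (F2 := fun i =>
  2%:R^-1 * ((n - 2 * i) * 'C(n - q - 1, i - q - 1))%:R))%R => [|i /andP[qi ik]]; last first.
  by rewrite natrM natrB ?natrM; [rewrite mulrAC mulrC mulrA | lia].
rewrite -mulr_sumr -(ltr_pM2l (ltr0Sn rat 1)) mulrA divff ?mul1r ?pnatr_eq0 //.
by rewrite mulrBr ltrBrDl.
Qed.
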